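(* Let $\mathcal{R}$, $\mathcal{S}$ and $\mathcal{T}$ be triangulated categories with a left recollement of $\mathcal{S}$ by $\mathcal{R}$ and $\mathcal{T}$ given by triangle functors $i^*:\mathcal{S}\to\mathcal{R}$, $i_*:\mathcal{R}\to\mathcal{S}$, $j_!:\mathcal{T}\to\mathcal{S}$, $j^*:\mathcal{S}\to\mathcal{T}$. Let $G_{\mathcal{R}}\in\mathcal{R}$, $G_{\mathcal{S}}\in\mathcal{S}$ and $G_{\mathcal{T}}\in\mathcal{T}$ be objects. (1) If $\mathrm{Hom}_{\mathcal{S}}(G_{\mathcal{S}}[n],G_{\mathcal{S}})=0$ for $n\gg 0$ and $i_*(G_{\mathcal{R}}),\,j_!(G_{\mathcal{T}})\in\langle G_{\mathcal{S}}\rangle$, then $$\mathrm{findim}(\mathcal{S},G_{\mathcal{S}})\le \mathrm{findim}(\mathcal{R},G_{\mathcal{R}})+\mathrm{findim}(\mathcal{T},G_{\mathcal{T}})+w_{G_{\mathcal{S}}}(i_*(G_{\mathcal{R}}))+w_{G_{\mathcal{S}}}(j_!(G_{\mathcal{T}}))+o^-(G_{\mathcal{S}})+1.$$ In this case, if both $\mathrm{findim}(\mathcal{R},G_{\mathcal{R}})$ and $\mathrm{findim}(\mathcal{T},G_{\mathcal{T}})$ are finite, then so is $\mathrm{findim}(\mathcal{S},G_{\mathcal{S}})$. (2) If $i^*(G_{\mathcal{S}})\in\langle G_{\mathcal{R}}\rangle$, then $$\mathrm{findim}(\mathcal{R},G_{\mathcal{R}})\le \mathrm{findim}(\mathcal{S},G_{\mathcal{S}})+w_{G_{\mathcal{R}}}(i^*(G_{\mathcal{S}})).$$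 In this case, if $\mathrm{findim}(\mathcal{S},G_{\mathcal{S}})$ is finite, then so is $\mathrm{findim}(\mathcal{R},G_{\mathcal{R}})$.
   Context: Left recollement: triangle functors $i^*,i_*,j_!,j^*$ as in the claim such that $(i^*,i_* )$ and $(j_!,j^* )$ are adjoint pairs, $i_*$ and $j_!$ are fully faithful, $j^*i_*=0$, and for each $Y\in\mathcal{S}$ the counit and unit of adjunction fit into a triangle $j_!j^*(Y)\to Y\to i_*i^*(Y)\to j_!j^*(Y)[1]$. For a triangulated category $\mathcal{S}$ and an object $G$: - $\langle G\rangle$ is the smallest full triangulated subcategory of $\mathcal{S}$ containing $G$ and closed under direct summands. For $A\le B$ in $\mathbb{Z}\cup\{\pm\infty\}$, $\langle G\rangle^{[A,B]}$ is the smallest full subcategory containing all $G[-i]$ with $i\in\mathbb{Z}$, $A\le i\le B$, and closed under extensions, finite direct sums and direct summands (round brackets are used at infinite ends, e.g. $\langle G\rangle^{[0,+\infty)}$). - $G(-\infty,-1]^{\perp}=\{X\in\mathcal{S}\mid \mathrm{Hom}_{\mathcal{S}}(G[n],X)=0\ \forall n\ge 1\}$. - Finitistic dimension of $\mathcal{S}$ at $G$: $\mathrm{findim}(\mathcal{S},G)=\inf\{n\in\mathbb{N}\mid G(-\infty,-1]^{\perp}\subseteq\langle G\rangle^{[0,+\infty)}[n]\}\in\mathbb{N}\cup\{+\infty\}$. - Width: for $P\in\langle G\rangle$, $w_G(P)=\min\{\beta-\alpha\mid \alpha\le\beta \text{ integers},\ P\in\langle G\rangle^{[\alpha,\beta]}\}$.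 - Lower self-orthogonal index: $o^-(G)=\inf\{b\ge 0\mid \mathrm{Hom}_{\mathcal{S}}(G[i],G)=0\text{ for all } i>b\}$. *)

(* Defs.v *)
From HB Require Import structures.
From mathcomp Require Import all_boot all_order all_algebra.
From mathcomp Require Import boolp classical_sets constructive_ereal.

Set Implicit Arguments.
Unset Strict Implicit.
Unset Printing Implicit Defensive.

Import Order.TTheory GRing.Theory Num.Theory.

Local Open Scope classical_set_scope.
Local Open Scope ring_scope.

Declare Scope cat_scope.
Reserved Notation "g \co f" (at level 40, left associativity).

Record preaddCat := PreaddCat {
  obj :> Type;
  hom : obj -> obj -> zmodType;
  idm : forall X, hom X X;
  comp : forall X Y Z, hom Y Z -> hom X Y -> hom X Z;
  compA : forall X Y Z W (h : hom Z W) (g : hom Y Z) (f : hom X Y),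
    comp h (comp g f) = comp (comp h g) f;
  comp1m : forall X Y (f : hom X Y), comp (idm Y) f = f;
  compm1 : forall X Y (f : hom X Y), comp f (idm X) = f;
  compDl : forall X Y Z (g1 g2 : hom Y Z) (f : hom X Y),
    comp (g1 + g2) f = comp g1 f + comp g2 f;
  compDr : forall X Y Z (g : hom Y Z) (f1 f2 : hom X Y),
    comp g (f1 + f2) = comp g f1 + comp g f2
}.

Arguments hom {_} X Y.
Arguments idm {_} X.
Arguments comp {_ X Y Z} g f.

Notation "g \co f" := (comp g f) : cat_scope.
Local Open Scope cat_scope.

Definition is_iso (C : preaddCat) (X Y : C) (f : hom X Y) : Prop :=
  exists g : hom Y X, g \co f = idm X /\ f \co g = idm Y.

Definition isomorphic (C : preaddCat) (X Y : C) : Prop :=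
  exists f : hom X Y, is_iso f.

Definition hom_zero (C : preaddCat) (X Y : C) : Prop :=
  forall f : hom X Y, f = 0.

Definition is_zero (C : preaddCat) (Z : C) : Prop :=
  (forall X : C, hom_zero X Z) /\ (forall X : C, hom_zero Z X).

Definition is_biproduct (C : preaddCat) (X Y P : C) : Prop :=
  exists (i1 : hom X P) (i2 : hom Y P) (p1 : hom P X) (p2 : hom P Y),
    [/\ p1 \co i1 = idm X, p2 \co i2 = idm Y,
        p2 \co i1 = 0, p1 \co i2 = 0
      & i1 \co p1 + i2 \co p2 = idm P].

Definition direct_summand (C : preaddCat) (X P : C) : Prop :=
  exists Y : C, is_biproduct X Y P.

Record addCat := AddCat {
  addCat_preaddCat :> preaddCat;
  has_zero : exists Z : addCat_preaddCat, is_zero Z;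
  has_biproduct : forall X Y : addCat_preaddCat,
    exists P : addCat_preaddCat, is_biproduct X Y P
}.

Record addFunctor (C D : preaddCat) := AddFunctor {
  fobj :> C -> D;
  fmap : forall X Y, {additive hom X Y -> hom (fobj X) (fobj Y)};
  fmap1 : forall X, fmap X X (idm X) = idm (fobj X);
  fmapM : forall X Y Z (g : hom Y Z) (f : hom X Y),
    fmap X Z (g \co f) = fmap Y Z g \co fmap X Y f
}.

Arguments fmap {C D} F {X Y} : rename.

Section FunctorComposition.
Variables C D E : preaddCat.

Definition idF : addFunctor C C :=
  @AddFunctor C C id (fun X Y => idfun : {additive hom X Y -> hom X Y})
    (fun X => erefl) (fun X Y Z g f => erefl).

Variables (G : addFunctor D E) (F : addFunctor C D).

Let cmap (X Y : C) : {additive hom X Y -> hom (G (F X)) (G (F Y))} :=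
  (fmap G (X := F X) (Y := F Y) \o fmap F (X := X) (Y := Y))%FUN.

Fact cmap1 X : cmap X X (idm X) = idm (G (F X)).
Proof. by rewrite /cmap /= !fmap1. Qed.

Fact cmapM X Y Z (g : hom Y Z) (f : hom X Y) :
  cmap X Z (g \co f) = cmap Y Z g \co cmap X Y f.
Proof. by rewrite /cmap /= !fmapM. Qed.

Definition compF : addFunctor C E := AddFunctor cmap1 cmapM.

End FunctorComposition.

Arguments idF {C}.

Definition natural (C D : preaddCat) (F G : addFunctor C D)
    (phi : forall X, hom (F X) (G X)) : Prop :=
  forall X Y (f : hom X Y), phi Y \co fmap F f = fmap G f \co phi X.

Definition fully_faithful (C D : preaddCat) (F : addFunctor C D) : Prop :=
  forall X Y : C, bijective (fmap F : hom X Y -> hom (F X) (F Y)).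

Record natIso (C D : preaddCat) (F G : addFunctor C D) := NatIso {
  nat_map :> forall X, hom (F X) (G X);
  nat_natural : natural nat_map;
  nat_iso : forall X, is_iso (nat_map X)
}.

Record adjunction (C D : preaddCat) (L : addFunctor C D) (R : addFunctor D C) :=
  Adjunction {
  adj_unit : forall X : C, hom X (R (L X));
  adj_counit : forall Y : D, hom (L (R Y)) Y;
  unit_natural : @natural C C idF (compF R L) adj_unit;
  counit_natural : @natural D D (compF L R) idF adj_counit;
  unit_counitL : forall X, adj_counit (L X) \co fmap L (adj_unit X) = idm (L X);
  unit_counitR : forall Y, fmap R (adj_counit Y) \co adj_unit (R Y) = idm (R Y)
}.

Arguments adj_unit {C D L R} a X : rename.
Arguments adj_counit {C D L R} a Y : rename.

(* The shift is an autoequivalence with quasi-inverse [unshift]; it need not  *)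
(* be invertible on objects up to equality, so X[m][n] and X[m + n] are only  *)
(* isomorphic in general.                                                     *)

Record triCat := TriCat {
  triCat_addCat :> addCat;
  shift : addFunctor triCat_addCat triCat_addCat;
  unshift : addFunctor triCat_addCat triCat_addCat;
  shiftK : natIso (compF unshift shift) idF;
  unshiftK : natIso (compF shift unshift) idF;
  dist : forall X Y Z : triCat_addCat,
    hom X Y -> hom Y Z -> hom Z (shift X) -> Prop;
  dist_iso : forall (X Y Z X' Y' Z' : triCat_addCat)
      (f : hom X Y) (g : hom Y Z) (h : hom Z (shift X))
      (f' : hom X' Y') (g' : hom Y' Z') (h' : hom Z' (shift X'))
      (u : hom X X') (v : hom Y Y') (w : hom Z Z'),
    is_iso u -> is_iso v -> is_iso w ->
    v \co f = f' \co u -> w \co g = g' \co v -> fmap shift u \co h = h' \co w ->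
    dist f g h -> dist f' g' h';
  dist_id : forall X Z : triCat_addCat, is_zero Z ->
    dist (idm X) (0 : hom X Z) (0 : hom Z (shift X));
  dist_cone : forall (X Y : triCat_addCat) (f : hom X Y),
    exists (Z : triCat_addCat) (g : hom Y Z) (h : hom Z (shift X)), dist f g h;
  dist_rot : forall (X Y Z : triCat_addCat)
      (f : hom X Y) (g : hom Y Z) (h : hom Z (shift X)),
    dist f g h <-> dist g h (- fmap shift f);
  dist_fill : forall (X Y Z X' Y' Z' : triCat_addCat)
      (f : hom X Y) (g : hom Y Z) (h : hom Z (shift X))
      (f' : hom X' Y') (g' : hom Y' Z') (h' : hom Z' (shift X'))
      (u : hom X X') (v : hom Y Y'),
    dist f g h -> dist f' g' h' -> v \co f = f' \co u ->
    exists w : hom Z Z', w \co g = g' \co v /\ fmap shift u \co h = h' \co w;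
  dist_octahedral : forall (X Y Z A B C : triCat_addCat)
      (f : hom X Y) (a : hom Y A) (a' : hom A (shift X))
      (g : hom Y Z) (b : hom Z B) (b' : hom B (shift Y))
      (c : hom Z C) (c' : hom C (shift X)),
    dist f a a' -> dist g b b' -> dist (g \co f) c c' ->
    exists (u : hom A C) (v : hom C B),
      [/\ dist u v (fmap shift a \co b'), u \co a = c \co g, c' \co u = a',
          v \co c = b & b' \co v = fmap shift f \co c']
}.

Arguments shift {_}.
Arguments unshift {_}.
Arguments dist {_ X Y Z} f g h.

(* [shiftz X n] is X[n]                                                       *)
Definition shiftz (S : triCat) (X : S) (n : int) : S :=
  match n with
  | Posz k => iter k (@shift S) X
  | Negz k => iter k.+1 (@unshift S) X
  end.

Record triFunctor (S T : triCat) := TriFunctor {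
  tri_fun :> addFunctor S T;
  tri_comm : natIso (compF tri_fun shift) (compF shift tri_fun);
  tri_dist : forall (X Y Z : S)
      (f : hom X Y) (g : hom Y Z) (h : hom Z (shift X)),
    dist f g h ->
    dist (fmap tri_fun f) (fmap tri_fun g) (tri_comm X \co fmap tri_fun h)
}.

Record left_recollement (R S T : triCat)
    (iu : triFunctor S R) (il : triFunctor R S)
    (jl : triFunctor T S) (ju : triFunctor S T) := LeftRecollement {
  recoll_i : adjunction iu il;
  recoll_j : adjunction jl ju;
  recoll_i_ff : fully_faithful il;
  recoll_j_ff : fully_faithful jl;
  recoll_ji : forall X : R, is_zero (ju (il X));
  recoll_dist : forall Y : S,
    exists h : hom (il (iu Y)) (shift (jl (ju Y))),
      dist (adj_counit recoll_j Y) (adj_unit recoll_i Y) h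
}.

(* A full subcategory is represented by its class of objects, [set S]         *)

Section Subcategories.
Variable S : triCat.
Implicit Types (P : set S) (G X Y Z : S).

Definition iso_closed P : Prop :=
  forall X Y, isomorphic X Y -> P X -> P Y.

Definition summand_closed P : Prop :=
  forall X Y, direct_summand X Y -> P Y -> P X.

Definition extension_closed P : Prop :=
  forall X Y Z (f : hom X Y) (g : hom Y Z) (h : hom Z (shift X)),
    dist f g h -> P X -> P Z -> P Y.

Definition cone_closed P : Prop :=
  forall X Y Z (f : hom X Y) (g : hom Y Z) (h : hom Z (shift X)),
    dist f g h -> P X -> P Y -> P Z.

(* All finite direct sums are iterated from the empty and the binary ones     *)
Definition sum_closed P : Prop :=
  (forall Z, is_zero Z -> P Z) /\
  (forall X Y Z, is_biproduct X Y Z -> P X -> P Y -> P Z).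

Record triangulated_subcat P : Prop := TriangulatedSubcat {
  sub_iso : iso_closed P;
  sub_sum : sum_closed P;
  sub_shift : forall X, P X -> P (shift X);
  sub_unshift : forall X, P X -> P (unshift X);
  sub_cone : cone_closed P
}.

Definition thick G : set S :=
  smallest [set P | triangulated_subcat P /\ summand_closed P] [set G].

(* <G>^[A,B] is [gen_itv G `[A, B]], <G>^[0,+oo) is [gen_itv G `[0, +oo[]     *)
Definition gen_itv G (I : interval int) : set S :=
  smallest [set P | [/\ extension_closed P, sum_closed P & summand_closed P]]
    [set shiftz G (- i) | i in [set i | i \in I]].

(* P[n], closed under isomorphisms                                            *)
Definition shift_sub P (n : int) : set S :=
  [set X | exists2 Y, P Y & isomorphic X (shiftz Y n)].

Definition right_perp G : set S :=
  [set X | forall n : nat, (1 <= n)%N -> hom_zero (shiftz G n%:Z) X].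

End Subcategories.

(* The infimum of A in the extended integers; it is +oo if A is empty         *)
Definition nat_inf (A : set nat) : \bar int :=
  infimum +oo%E [set (n%:Z)%:E | n in A].

Definition findim (S : triCat) (G : S) : \bar int :=
  nat_inf [set n | right_perp G `<=` shift_sub (gen_itv G `[0, +oo[) n%:Z].

(* This is +oo if P is not an object of <G>                                   *)
Definition width (S : triCat) (G P : S) : \bar int :=
  nat_inf [set n | exists a b : int,
    [/\ a <= b, b - a = n%:Z & gen_itv G `[a, b] P]].

Definition lower_index (S : triCat) (G : S) : \bar int :=
  nat_inf [set b | forall i : int, b%:Z < i -> hom_zero (shiftz G i) G].

(* Main.v *)
(* For an adjoint pair (L, R) of triangle functors, Hom(L G[n], X) vanishes   *)
(* iff Hom(G[n], R X) does; if L G lies in <H>^[a,b] and Hom(H[n], X) = 0 for *)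
(* n > 0, this holds for n > b.  For (2), apply this to (iu, il) to place     *)
(* il X in <GS>^[-(findim GS + b),+oo), and return to R by iu, which costs    *)
(* the lower end a.  For (1), apply it first to (jl, ju) to bound jl ju X:    *)
(* by the definition of the lower index, Hom(GS[n], jl ju X[1]) = 0 for large *)
(* n.  The recollement triangle then gives Hom(GS[n], il iu X) = 0, which     *)
(* bounds il iu X in the same way, and X is an extension of il iu X by        *)
(* jl ju X.                                                                   *)

Require Import Defs.
From mathcomp Require Import all_boot all_order all_algebra.
From mathcomp Require Import boolp classical_sets constructive_ereal.
From mathcomp Require Import zify.
(* Again, as [all_algebra] shadows [hom]. *)
Import Defs.

Set Implicit Arguments.
Unset Strict Implicit.
Unset Printing Implicit Defensive.

Import Order.TTheory GRing.Theory Num.Theory.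

Local Open Scope classical_set_scope.
Local Open Scope ring_scope.
Local Open Scope cat_scope.

(** The proof is devissage. Since [gen_itv G I] is a smallest class, a statement about its objects
    follows from the case of the shifts of [G], once the objects satisfying it form an [esd_closed]
    class ([gen_itv_ind]). The measuring tool is [right_perp_gen_itv]: if findim G = n and Hom(G[k],
    X) = 0 for k > d, then X lies in <G>^[-(n+d),+oo). Changing generators when one lies in
    <H>^[a,b] raises the Hom bound by b ([gen_itv_hom_zerol]) and moves the lower end of the
    generation range by a ([gen_itv_trans]), so in total only the width b - a is paid. Part (2),
    [findim_quotient_le], pays this once. In part (1), [findim_recollement_le], the term jl ju X
    costs findim GT and one width. Turning its generation range back into Hom vanishing costs the
    lower index, and the connecting map into jl ju X[1] costs the final 1. The term il iu X then
    adds findim GR and the other width. *)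

Section Preadditive.
Variable C : preaddCat.
Implicit Types X Y Z : C.

Lemma comp0m X Y Z (f : hom X Y) : (0 : hom Y Z) \co f = 0.
Proof. by apply: (addrI (0 \co f)); rewrite -compDl !addr0. Qed.

Lemma compm0 X Y Z (g : hom Y Z) : g \co (0 : hom X Y) = 0.
Proof. by apply: (addrI (g \co 0)); rewrite -compDr !addr0. Qed.

Lemma compNm X Y Z (g : hom Y Z) (f : hom X Y) : (- g) \co f = - (g \co f).
Proof. by apply: (addrI (g \co f)); rewrite -compDl !subrr comp0m. Qed.

Lemma compmN X Y Z (g : hom Y Z) (f : hom X Y) : g \co (- f) = - (g \co f).
Proof. by apply: (addrI (g \co f)); rewrite -compDr !subrr compm0. Qed.

Lemma compBl X Y Z (g1 g2 : hom Y Z) (f : hom X Y) :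
  (g1 - g2) \co f = g1 \co f - g2 \co f.
Proof. by rewrite compDl compNm. Qed.

Lemma compBr X Y Z (g : hom Y Z) (f1 f2 : hom X Y) :
  g \co (f1 - f2) = g \co f1 - g \co f2.
Proof. by rewrite compDr compmN. Qed.

Lemma isomorphic_refl X : isomorphic X X.
Proof. by exists (idm X), (idm X); rewrite !comp1m. Qed.

Lemma isomorphic_sym X Y : isomorphic X Y -> isomorphic Y X.
Proof. by case=> f [g [gf fg]]; exists g, f. Qed.

Lemma isomorphic_trans Y X Z :
  isomorphic X Y -> isomorphic Y Z -> isomorphic X Z.
Proof.
case=> f [f' [f'f ff']] [g [g' [g'g gg']]]; exists (g \co f), (f' \co g').
split; first by rewrite compA -(compA f') g'g compm1.
by rewrite compA -(compA g) ff' compm1.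
Qed.

Lemma two_sided_is_iso X Y (f : hom X Y) (g h : hom Y X) :
  g \co f = idm X -> f \co h = idm Y -> is_iso f.
Proof.
move=> gf fh; exists g; split => //.
by rewrite -[RHS]fh -[in RHS](comp1m h) -gf -!compA fh compm1.
Qed.

Lemma hom_zero_isol X X' Y : isomorphic X X' -> hom_zero X Y -> hom_zero X' Y.
Proof.
case=> f [g [_ fg]] XY0 k.
by rewrite -(compm1 k) -fg compA (XY0 (k \co f)) comp0m.
Qed.

Lemma hom_zero_isor X Y Y' : isomorphic Y Y' -> hom_zero X Y -> hom_zero X Y'.
Proof.
case=> f [g [_ fg]] XY0 k.
by rewrite -(comp1m k) -fg -compA (XY0 (g \co k)) compm0.
Qed.

Lemma is_zeroP Z : is_zero Z <-> idm Z = 0.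
Proof.
split=> [[Z0 _]|Z0]; first exact: Z0.
split=> X f; first by rewrite -(comp1m f) Z0 comp0m.
by rewrite -(compm1 f) Z0 compm0.
Qed.

End Preadditive.

(** * Additive functors and adjunctions *)

Section AdditiveFunctor.
Variables (C D : preaddCat) (F : addFunctor C D).

Lemma fmap_is_iso X Y (f : hom X Y) : is_iso f -> is_iso (fmap F f).
Proof.
by case=> g [gf fg]; exists (fmap F g); rewrite -!fmapM gf fg !fmap1.
Qed.

Lemma fmap_isomorphic X Y : isomorphic X Y -> isomorphic (F X) (F Y).
Proof. by case=> f f_iso; exists (fmap F f); apply: fmap_is_iso. Qed.

Lemma fmap_is_zero Z : is_zero Z -> is_zero (F Z).
Proof. by move/is_zeroP=> Z0; apply/is_zeroP; rewrite -fmap1 Z0 raddf0. Qed.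

Lemma fmap_is_biproduct X Y P :
  is_biproduct X Y P -> is_biproduct (F X) (F Y) (F P).
Proof.
case=> i1 [i2 [p1 [p2 [e11 e22 e21 e12 e]]]].
exists (fmap F i1), (fmap F i2), (fmap F p1), (fmap F p2).
split; rewrite -!fmapM ?e11 ?e22 ?e21 ?e12 ?fmap1 ?raddf0 //.
by rewrite -raddfD e fmap1.
Qed.

End AdditiveFunctor.

(** By naturality and a triangle identity every map is recovered from its transpose, and additive
    functors preserve 0. *)
Lemma adj_hom_zero (C D : preaddCat) (L : addFunctor C D) (R : addFunctor D C)
    (adj : adjunction L R) (X : C) (Y : D) :
  hom_zero (L X) Y <-> hom_zero X (R Y).
Proof.
split=> H f.
- have := unit_natural adj f => /= f_nat.
  rewrite -[f]comp1m -(unit_counitR adj) -compA f_nat compA -fmapM.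
  by rewrite (H (_ \co _)) raddf0 comp0m.
- have := counit_natural adj f => /= f_nat.
  rewrite -[f]compm1 -(unit_counitL adj) compA -f_nat -compA -fmapM.
  by rewrite (H (_ \co _)) raddf0 compm0.
Qed.

(** * The shift as an autoequivalence *)

Section Shift.
Variable S : triCat.
Implicit Types X Y Z : S.

Lemma unshift_shift X : isomorphic (unshift (shift X)) X.
Proof. by exists (shiftK S X); apply: (nat_iso (shiftK S) X). Qed.

Lemma shift_unshift X : isomorphic (shift (unshift X)) X.
Proof. by exists (unshiftK S X); apply: (nat_iso (unshiftK S) X). Qed.

Lemma shift_inj X Y : injective (fmap shift : hom X Y -> _).
Proof.
move=> f f' eq_f; case: (nat_iso (shiftK S) X) => v [_ ev].
have n1 : _ = f \co _ := nat_natural (shiftK S) f.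
have n2 : _ = f' \co _ := nat_natural (shiftK S) f'.
by rewrite -[f]compm1 -[f']compm1 -ev !compA -n1 -n2 /= eq_f.
Qed.

Lemma unshift_inj X Y : injective (fmap unshift : hom X Y -> _).
Proof.
move=> f f' eq_f; case: (nat_iso (unshiftK S) X) => v [_ ev].
have n1 : _ = f \co _ := nat_natural (unshiftK S) f.
have n2 : _ = f' \co _ := nat_natural (unshiftK S) f'.
by rewrite -[f]compm1 -[f']compm1 -ev !compA -n1 -n2 /= eq_f.
Qed.

(** Conjugating [fmap unshift g] by [shiftK] gives f with the same image as g after [unshift];
    faithfulness of [unshift] finishes. *)
Lemma shift_full X Y (g : hom (shift X) (shift Y)) :
  exists f : hom X Y, fmap shift f = g.
Proof.
have [x [xl xr]] := nat_iso (shiftK S) X.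
have [y [yl yr]] := nat_iso (shiftK S) Y.
exists (shiftK S Y \co fmap unshift g \co x); apply: unshift_inj.
set f := _ \co x.
have n : shiftK S Y \co fmap unshift (fmap shift f) = f \co shiftK S X :=
  nat_natural (shiftK S) f.
have := congr1 (comp y) n; rewrite compA yl comp1m => ->.
by rewrite /f -compA xl compm1 compA yl comp1m.
Qed.

Lemma hom_zero_shift X Y : hom_zero (shift X) (shift Y) <-> hom_zero X Y.
Proof.
split=> XY0 f; first by apply: shift_inj; rewrite (XY0 (fmap shift f)) raddf0.
by have [g <-] := shift_full f; rewrite (XY0 g) raddf0.
Qed.

End Shift.

(** * Exact triangles and classes closed under extensions, sums and summands *)

Section Triangles.
Variable S : triCat.
Implicit Types (X Y Z W : S) (P : set S).

Lemma dist_0_id Z0 W : is_zero Z0 ->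
  dist (0 : hom Z0 W) (idm W) (0 : hom W (shift Z0)).
Proof.
move=> Z0_zero; apply/dist_rot; rewrite raddf0 oppr0.
exact/dist_id/fmap_is_zero.
Qed.

(** [dist_fill] supplies only a third map, so both triangles are rotated until the wanted map is
    third; it then appears shifted, and full faithfulness of [shift] brings it back. *)
Lemma dist_lift X Y Z W (f : hom X Y) (g : hom Y Z) (h : hom Z (shift X))
    (k : hom W Y) :
  dist f g h -> g \co k = 0 -> exists l : hom W X, k = f \co l.
Proof.
move=> /dist_rot fgh gk0; have [Z0 Z0_zero] := has_zero S.
have /dist_rot W_tri := dist_id W Z0_zero.
have [|w [_]] := dist_fill (u := k) (v := 0 : hom Z0 Z) W_tri fgh.
  by rewrite gk0 comp0m.
have [l <-] := shift_full w; rewrite fmap1 compmN compm1 compNm -fmapM.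
by move/oppr_inj/shift_inj=> ->; exists l.
Qed.

Lemma dist_colift X Y Z W (f : hom X Y) (g : hom Y Z) (h : hom Z (shift X))
    (k : hom Y W) :
  dist f g h -> k \co f = 0 -> exists l : hom Z W, k = l \co g.
Proof.
move=> fgh kf0; have [Z0 Z0_zero] := has_zero S.
have [|w [wg _]] := dist_fill (u := 0) (v := k) fgh (dist_0_id W Z0_zero).
  by rewrite kf0 compm0.
by exists w; rewrite wg comp1m.
Qed.

(* Such an [e] is [1 + n] with [n \co n = 0]: as [n \co g = 0], [n] factors   *)
(* through [h], and [h \co n = 0].                                            *)
Lemma dist_endo_is_iso X Y Z (f : hom X Y) (g : hom Y Z) (h : hom Z (shift X))
    (e : hom Z Z) :
  dist f g h -> e \co g = g -> h \co e = h -> is_iso e.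
Proof.
move=> /dist_rot fgh eg he.
have [|l e1] := dist_colift (k := e - idm Z) fgh.
  by rewrite compBl eg comp1m subrr.
have nn0 : (e - idm Z) \co (e - idm Z) = 0.
  by rewrite {1}e1 -compA compBr he compm1 subrr compm0.
have ne : (e - idm Z) \co e = e - idm Z.
  by apply/eqP; rewrite -subr_eq0 -[X in _ - X]compm1 -compBr nn0.
have en : e \co (e - idm Z) = e - idm Z.
  by apply/eqP; rewrite -subr_eq0 -[X in _ - X]comp1m -compBl nn0.
exists (idm Z - (e - idm Z)); rewrite compBl compBr ne en comp1m compm1.
by rewrite !subKr.
Qed.

(** Fill in maps between the cones both ways. The composites fix the other maps of the triangles, so
    [dist_endo_is_iso] makes them invertible. *)
Lemma cone_isomorphic X Y Z X' Y' Z'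
    (f : hom X Y) (g : hom Y Z) (h : hom Z (shift X))
    (f' : hom X' Y') (g' : hom Y' Z') (h' : hom Z' (shift X'))
    (u : hom X X') (v : hom Y Y') :
  dist f g h -> dist f' g' h' -> is_iso u -> is_iso v ->
  v \co f = f' \co u -> isomorphic Z Z'.
Proof.
move=> fgh fgh' [u' [u'u uu']] [v' [v'v vv']] vf.
have v'f' : v' \co f' = f \co u'.
  by rewrite -[f']compm1 -uu' (compA f') -vf !compA v'v comp1m.
have [w [wg hw]] := dist_fill fgh fgh' vf.
have [w' [wg' hw']] := dist_fill fgh' fgh v'f'.
have [a [aw _]] : is_iso (w' \co w).
  apply: (dist_endo_is_iso fgh).
    by rewrite -compA wg compA wg' -compA v'v compm1.
  by rewrite compA -hw' -compA -hw compA -fmapM u'u fmap1 comp1m.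
have [b [_ wb]] : is_iso (w \co w').
  apply: (dist_endo_is_iso fgh').
    by rewrite -compA wg' compA wg -compA vv' compm1.
  by rewrite compA -hw -compA -hw' compA -fmapM uu' fmap1 comp1m.
exists w; apply: (@two_sided_is_iso _ _ _ _ (a \co w') (w' \co b)).
  by rewrite -compA.
by rewrite compA.
Qed.

Lemma dist_shift X Y Z (f : hom X Y) (g : hom Y Z) (h : hom Z (shift X)) :
  dist f g h -> dist (- fmap shift f) (- fmap shift g) (- fmap shift h).
Proof. by do 3!move/dist_rot. Qed.

(* Closed under Extensions, Sums and Direct summands *)
Definition esd_closed P :=
  [/\ extension_closed P, sum_closed P & summand_closed P].

(** An object isomorphic to [X] is a summand of [X] with zero complement. *)
Lemma esd_iso P X Y : esd_closed P -> isomorphic X Y -> P X -> P Y.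
Proof.
case=> _ _ summandP [f [g [gf fg]]]; apply: (summandP Y X).
have [Z Z_zero] := has_zero S; have /is_zeroP Z0 := Z_zero.
exists Z, g, 0, f, 0.
by split; rewrite ?fg ?comp0m ?compm0 ?Z0 ?gf ?addr0.
Qed.

Lemma esd_shift_preim P : esd_closed P -> esd_closed [set X | P (shift X)].
Proof.
case=> extP [zeroP sumP] summandP; split=> [X Y Z f g h||X Y [Z]] /=.
- by move/dist_shift; apply: extP.
- split=> [Z /(fmap_is_zero shift)|X Y Z /(fmap_is_biproduct shift)].
    exact: zeroP.
  exact: sumP.
- move/(fmap_is_biproduct shift)=> XZY; apply: summandP.
  by exists (shift Z).
Qed.

(* The cone [C] of [unshift f] satisfies [shift C] isomorphic to [Z], by      *)
(* comparing the shifted triangle with [dist f g h].                          *)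
Lemma esd_unshift_preim P :
  esd_closed P -> esd_closed [set X | P (unshift X)].
Proof.
move=> P_esd; have [extP [zeroP sumP] summandP] := P_esd.
split=> [X Y Z f g h fgh PX PZ||X Y [Z]] /=.
- have [C [g' [h' tri]]] := dist_cone (fmap unshift f).
  apply: (extP _ _ _ _ _ _ tri) => //; apply: (esd_iso P_esd _ PZ).
  apply: isomorphic_trans (unshift_shift C).
  apply/fmap_isomorphic/isomorphic_sym.
  (* The sign on [unshiftK S X] absorbs the one that [dist_shift] puts on the first map. *)
  apply: (cone_isomorphic (u := - unshiftK S X) (v := unshiftK S Y)
    (dist_shift tri) fgh).
  + case: (nat_iso (unshiftK S) X) => x [xl xr].
    by exists (- x); rewrite compNm compmN opprK xl compNm compmN opprK xr.
  + exact: nat_iso.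
  + rewrite !compmN; congr (- _); exact: (nat_natural (unshiftK S) f).
- split=> [Z /(fmap_is_zero unshift)|X Y Z /(fmap_is_biproduct unshift)].
    exact: zeroP.
  exact: sumP.
- move/(fmap_is_biproduct unshift)=> XZY; apply: summandP.
  by exists (unshift Z).
Qed.

Lemma esd_iter_preim (K : S -> S) P n :
  (forall Q, esd_closed Q -> esd_closed [set X | Q (K X)]) ->
  esd_closed P -> esd_closed [set X | P (iter n K X)].
Proof. by move=> K_esd; elim: n P => //= n IHn P /K_esd/IHn. Qed.

Lemma esd_shiftz_preim P n :
  esd_closed P -> esd_closed [set X | P (shiftz X n)].
Proof.
case: n => n; apply: esd_iter_preim.
- exact: esd_shift_preim.
- exact: esd_unshift_preim.
Qed.

(** Hom(-, W) is exact in the middle of a triangle: a map killing [X] factors through [Z]. *)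
Lemma esd_hom_zerol W : esd_closed [set X | hom_zero X W].
Proof.
split=> [X Y Z f g h fgh XW0 ZW0 k||X Y [Z]] /=.
- have [|l ->] := dist_colift (k := k) fgh; first exact: XW0.
  by rewrite (ZW0 l) comp0m.
- split=> [Z [_ Z0]|X Y Z [i1 [i2 [p1 [p2 [_ _ _ _ e]]]]] X0 Y0 k].
    exact: Z0.
  rewrite -(compm1 k) -e compDr !compA (X0 (k \co i1)) (Y0 (k \co i2)).
  by rewrite !comp0m addr0.
- case=> i1 [i2 [p1 [p2 [e1 _ _ _ _]]]] Y0 k.
  by rewrite -(compm1 k) -e1 compA (Y0 (k \co p1)) comp0m.
Qed.

Lemma esd_hom_zeror W : esd_closed [set X | hom_zero W X].
Proof.
split=> [X Y Z f g h fgh WX0 WZ0 k||X Y [Z]] /=.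
- have [|l ->] := dist_lift (k := k) fgh; first exact: WZ0.
  by rewrite (WX0 l) compm0.
- split=> [Z [Z0 _]|X Y Z [i1 [i2 [p1 [p2 [_ _ _ _ e]]]]] X0 Y0 k].
    exact: Z0.
  rewrite -(comp1m k) -e compDl -!compA (X0 (p1 \co k)) (Y0 (p2 \co k)).
  by rewrite !compm0 addr0.
- case=> i1 [i2 [p1 [p2 [e1 _ _ _ _]]]] Y0 k.
  by rewrite -(comp1m k) -e1 -compA (Y0 (i1 \co k)) compm0.
Qed.

End Triangles.

(** * Integer shifts, up to isomorphism *)

Section IteratedShift.
Variable S : triCat.
Implicit Types (X Y : S) (m n : int).

Lemma shiftz_addn1 X n : isomorphic (shiftz X (n + 1)) (shift (shiftz X n)).
Proof.
apply: isomorphic_sym; case: n => [n|[|n]].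
- by rewrite -PoszD addn1; exact: isomorphic_refl.
- exact: shift_unshift.
- have -> : Negz n.+1 + 1 = Negz n by rewrite !NegzE; lia.
  exact: shift_unshift.
Qed.

Lemma shiftz_subn1 X n : isomorphic (shiftz X (n - 1)) (unshift (shiftz X n)).
Proof.
apply: isomorphic_trans (isomorphic_sym (unshift_shift _)) _.
apply/fmap_isomorphic/isomorphic_sym.
by rewrite -{1}(subrK 1 n); apply: shiftz_addn1.
Qed.

Lemma shiftz_isomorphic X Y n :
  isomorphic X Y -> isomorphic (shiftz X n) (shiftz Y n).
Proof.
move=> XY; elim/int_rect: n => [//|n IHn|n IHn].
- exact: (fmap_isomorphic shift IHn).
- rewrite -[n.+1]addn1 PoszD opprD.
  apply: isomorphic_trans (shiftz_subn1 X _) _.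
  apply: isomorphic_trans (isomorphic_sym (shiftz_subn1 Y _)).
  exact: (fmap_isomorphic unshift IHn).
Qed.

Lemma shiftzD X m n : isomorphic (shiftz (shiftz X m) n) (shiftz X (m + n)).
Proof.
elim/int_rect: n => [|n IHn|n IHn].
- by rewrite addr0; exact: isomorphic_refl.
- rewrite -[n.+1]addn1 PoszD addrA.
  apply: isomorphic_trans (shiftz_addn1 _ _) _.
  apply: isomorphic_trans (isomorphic_sym (shiftz_addn1 _ _)).
  exact: (fmap_isomorphic shift IHn).
- rewrite -[n.+1]addn1 PoszD opprD addrA.
  apply: isomorphic_trans (shiftz_subn1 _ _) _.
  apply: isomorphic_trans (isomorphic_sym (shiftz_subn1 _ _)).
  exact: (fmap_isomorphic unshift IHn).
Qed.

Lemma shiftzNK X n : isomorphic (shiftz (shiftz X n) (- n)) X.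
Proof.
apply: isomorphic_trans (shiftzD _ _ _) _; rewrite subrr.
exact: isomorphic_refl.
Qed.

Lemma hom_zero_shiftz X Y n :
  hom_zero X Y -> hom_zero (shiftz X n) (shiftz Y n).
Proof.
move=> XY0; elim/int_rect: n => [//|n IHn|n IHn]; first exact/hom_zero_shift.
apply/hom_zero_shift.
have sK (Z : S) : isomorphic (shiftz Z (- n%:Z)) (shift (shiftz Z (- n.+1%:Z))).
  have -> : - n%:Z = - n.+1%:Z + 1 by lia.
  exact: shiftz_addn1.
exact/(hom_zero_isor (sK _))/(hom_zero_isol (sK _)).
Qed.

Lemma hom_zero_shiftzl X Y m n :
  hom_zero (shiftz X (m - n)) Y -> hom_zero (shiftz X m) (shiftz Y n).
Proof.
move/hom_zero_shiftz=> /(_ n); apply: hom_zero_isol.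
apply: isomorphic_trans (shiftzD _ _ _) _; rewrite subrK.
exact: isomorphic_refl.
Qed.

End IteratedShift.

(** * Triangle functors and shifts *)

Section TriangleFunctor.
Variables (S T : triCat) (F : triFunctor S T).

Lemma tri_shift X : isomorphic (F (shift X)) (shift (F X)).
Proof. by exists (tri_comm F X); apply: (nat_iso (tri_comm F) X). Qed.

Lemma tri_unshift X : isomorphic (F (unshift X)) (unshift (F X)).
Proof.
apply: isomorphic_trans (isomorphic_sym (unshift_shift _)) _.
apply: fmap_isomorphic.
apply: isomorphic_trans (isomorphic_sym (tri_shift _)) _.
exact/fmap_isomorphic/shift_unshift.
Qed.

Lemma tri_shiftz X n : isomorphic (F (shiftz X n)) (shiftz (F X) n).
Proof.
case: n => n; elim: n => [|n IHn] /=.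
- exact: isomorphic_refl.
- exact: isomorphic_trans (tri_shift _) (fmap_isomorphic shift IHn).
- exact: tri_unshift.
- exact: isomorphic_trans (tri_unshift _) (fmap_isomorphic unshift IHn).
Qed.

Lemma esd_tri_preim (P : set T) : esd_closed P -> esd_closed [set X | P (F X)].
Proof.
case=> extP [zeroP sumP] summandP; split=> [X Y Z f g h||X Y [Z]] /=.
- by move/(tri_dist F); apply: extP.
- split=> [Z /(fmap_is_zero F)|X Y Z /(fmap_is_biproduct F)].
    exact: zeroP.
  exact: sumP.
- move/(fmap_is_biproduct F)=> XZY; apply: summandP.
  by exists (F Z).
Qed.

End TriangleFunctor.

(** * Devissage for the classes <G>^I *)

Section Generation.
Variable S : triCat.
Implicit Types (G X Y : S) (I J K : interval int).

Lemma esd_gen_itv G I : esd_closed (gen_itv G I).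
Proof.
split=> [X Y Z f g h fgh PX PZ Q QG||X Y XY PY Q QG].
- have [[extQ _ _] _] := QG.
  by apply: (extQ _ _ _ _ _ _ fgh); [exact: PX | exact: PZ].
- split=> [Z Z0 Q [[_ [zeroQ _] _] _]|X Y Z XYZ PX PY Q QG]; first exact: zeroQ.
  have [[_ [_ sumQ] _] _] := QG.
  by apply: (sumQ _ _ _ XYZ); [exact: PX | exact: PY].
- by have [[_ _ summandQ] _] := QG; apply: (summandQ _ _ XY); apply: PY.
Qed.

Lemma gen_itv_iso G I X Y : isomorphic X Y -> gen_itv G I X -> gen_itv G I Y.
Proof. exact: (esd_iso (esd_gen_itv G I)). Qed.

Lemma gen_itv_base G I i : - i \in I -> gen_itv G I (shiftz G i).
Proof.
by move=> iI; apply: sub_gen_smallest; exists (- i) => //; rewrite opprK.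
Qed.

Lemma gen_itv_ind G I (P : set S) : esd_closed P ->
  (forall i, - i \in I -> P (shiftz G i)) -> gen_itv G I `<=` P.
Proof.
move=> P_esd PG; apply: smallest_sub => // _ [i /= iI <-].
by apply: PG; rewrite opprK.
Qed.

Lemma gen_itv_shift G I J X n : (forall i, i \in I -> i - n \in J) ->
  gen_itv G I X -> gen_itv G J (shiftz X n).
Proof.
move=> IJ; move: X; apply: gen_itv_ind.
  exact/esd_shiftz_preim/esd_gen_itv.
move=> i /IJ iJ /=; apply: gen_itv_iso (isomorphic_sym (shiftzD _ _ _)) _.
by apply: gen_itv_base; rewrite opprD.
Qed.

(** Degrees add when a generator is itself resolved by another: [K] need only contain the sumset of
    [I] and [J]. *)
Lemma gen_itv_trans G I H J K X : gen_itv G I H ->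
  (forall i j, i \in I -> j \in J -> i + j \in K) ->
  gen_itv H J X -> gen_itv G K X.
Proof.
move=> GH IJK; move: X; apply: gen_itv_ind; first exact: esd_gen_itv.
by move=> j jJ; apply: gen_itv_shift GH => i iI; apply: IJK.
Qed.

Lemma gen_itv_sub G I J : (forall i, i \in I -> i \in J) ->
  gen_itv G I `<=` gen_itv G J.
Proof.
move=> IJ; apply: gen_itv_ind (esd_gen_itv _ _) _ => i /IJ.
exact: gen_itv_base.
Qed.

(** The objects whose n-th shift has no nonzero map to [X] form an [esd_closed] class, so it
    suffices to treat the generators. *)
Lemma gen_itv_hom_zerol G I H X n : gen_itv G I H ->
  (forall i, i \in I -> hom_zero (shiftz G (n - i)) X) ->
  hom_zero (shiftz H n) X.
Proof.
move=> GH G0; move: H GH; apply: gen_itv_ind.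
  exact/(esd_shiftz_preim (P := [set H | hom_zero H X]))/esd_hom_zerol.
move=> i /G0 iI /=; apply: hom_zero_isol iI.
by rewrite opprK addrC; apply/isomorphic_sym/shiftzD.
Qed.

Lemma gen_itv_hom_zeror G I W X : gen_itv G I X ->
  (forall i, i \in I -> hom_zero W (shiftz G (- i))) -> hom_zero W X.
Proof.
move=> GX W0; move: X GX; apply: gen_itv_ind; first exact: esd_hom_zeror.
by move=> i /W0; rewrite opprK.
Qed.

End Generation.

Lemma gen_itv_fmap (S T : triCat) (F : triFunctor S T) (G X : S) I :
  gen_itv G I X -> gen_itv (F G) I (F X).
Proof.
move: X; apply: gen_itv_ind; first exact/esd_tri_preim/esd_gen_itv.
move=> i iI /=; apply: gen_itv_iso (isomorphic_sym (tri_shiftz _ _ _)) _.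
exact: gen_itv_base.
Qed.

(** * Infima of sets of naturals in the extended integers *)

Section NatInf.
Implicit Types (A : set nat) (n : nat).

Lemma nat_inf_set0 : nat_inf set0 = +oo%E.
Proof. by rewrite /nat_inf image_set0 /infimum eqxx. Qed.

(** A nonempty set of naturals has a least element, and infima are unique. *)
Lemma nat_infE A n : A n -> exists2 m, A m & nat_inf A = (m%:Z)%:E.
Proof.
move=> An; have exA : exists m, `[< A m >] by exists n; apply/asboolP.
case: (ex_minnP exA) => m /asboolP Am m_min; exists m => //.
rewrite /nat_inf /infimum ifN; last by apply/set0P; exists (m%:Z)%:E, m.
apply: xget_subset1; last exact: is_subset1_infimums.
split=> [_ [k Ak <-]|x x_lb]; last by apply: x_lb; exists m.
by rewrite lee_fin lez_nat m_min //; apply/asboolP.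
Qed.

Lemma nat_inf_le A n : A n -> (nat_inf A <= (n%:Z)%:E)%E.
Proof.
move=> An; have exA : exists m, `[< A m >] by exists n; apply/asboolP.
rewrite /nat_inf; apply: le_infimum_Nmem; last by exists n.
case: (ex_minnP exA) => m /asboolP Am m_min; exists (m%:Z)%:E.
split=> [_ [k Ak <-]|x x_lb]; last by apply: x_lb; exists m.
by rewrite lee_fin lez_nat m_min //; apply/asboolP.
Qed.

End NatInf.

(** * Finitistic dimension, width and lower index *)

Section Dimension.
Variable S : triCat.
Implicit Types (G P X Y : S).

Lemma findim_le G (n : nat) :
  (forall X, right_perp G X -> gen_itv G `[- n%:Z, +oo[ X) ->
  (findim G <= (n%:Z)%:E)%E.
Proof.
move=> Gn; apply: nat_inf_le => X /Gn GX.
exists (shiftz X (- n%:Z)).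
  by apply: gen_itv_shift GX => i; rewrite !in_itv /=; lia.
apply: isomorphic_sym; rewrite -{2}(opprK n%:Z); exact: shiftzNK.
Qed.

(** The value -oo is excluded, so any finite upper bound makes [findim] finite. *)
Lemma findimP G : (exists2 n : nat,
    right_perp G `<=` shift_sub (gen_itv G `[0, +oo[) n%:Z
    & findim G = (n%:Z)%:E) \/ findim G = +oo%E.
Proof.
rewrite /findim; set A := [set n | _].
have [->|/set0P [n /nat_infE]] := eqVneq A set0; last by left.
by right; exact: nat_inf_set0.
Qed.

(** The shift X[-d] lies in [right_perp G], hence in <G>^[-n,+oo); shifting back by d lowers the end
    to -(n+d). *)
Lemma right_perp_gen_itv G (n : nat) (d : int) X :
  right_perp G `<=` shift_sub (gen_itv G `[0, +oo[) n%:Z ->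
  (forall k, d < k -> hom_zero (shiftz G k) X) ->
  gen_itv G `[- (n%:Z + d), +oo[ X.
Proof.
move=> Gn GX0.
have /Gn [Y GY XY] : right_perp G (shiftz X (- d)).
  move=> k k_gt0; apply: hom_zero_shiftzl; apply: GX0; lia.
apply: gen_itv_iso (_ : gen_itv _ _ (shiftz (shiftz Y n) d)).
  apply: isomorphic_trans (shiftz_isomorphic d (isomorphic_sym XY)) _.
  by rewrite -{2}(opprK d); apply: shiftzNK.
apply: (gen_itv_shift (I := `[- n%:Z, +oo[)); last apply: gen_itv_shift GY.
all: by move=> i; rewrite !in_itv /=; lia.
Qed.

(** The objects of bounded range form a thick subcategory containing [G]. *)
Lemma thick_gen_itv G P : thick G P ->
  exists a b : int, a <= b /\ gen_itv G `[a, b] P.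
Proof.
pose Q := [set P | exists a b : int, a <= b /\ gen_itv G `[a, b] P].
have subQ (a b c d : int) X : c <= a -> b <= d ->
    gen_itv G `[a, b] X -> gen_itv G `[c, d] X.
  by move=> ca bd; apply: gen_itv_sub => i; rewrite !in_itv /=; lia.
apply: (@smallest_sub _ _ _ Q); last first.
  move=> _ ->; exists 0, 0; split=> //.
  by apply: (gen_itv_base (i := 0)); rewrite in_itv.
have joinQ X Y : Q X -> Q Y -> exists a b : int,
    [/\ a <= b, gen_itv G `[a, b] X & gen_itv G `[a, b] Y].
  case=> a [b [ab GX]] [c [d [cd GY]]]; exists (Num.min a c), (Num.max b d).
  by split; [lia|apply: subQ GX; lia|apply: subQ GY; lia].
split; last first.
  move=> X Y XY [a [b [ab GY]]]; exists a, b; split=> //.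
  by have [_ _] := esd_gen_itv G `[a, b]; apply; first exact: XY.
split.
- move=> X Y XY [a [b [ab GX]]]; exists a, b; split=> //.
  exact: gen_itv_iso XY GX.
- split=> [Z Z0|X Y Z XYZ QX QY].
    exists 0, 0; split=> //.
    by have [_ [zeroG _] _] := esd_gen_itv G `[0, 0]; exact: zeroG.
  have [a [b [ab GX GY]]] := joinQ _ _ QX QY; exists a, b; split=> //.
  by have [_ [_ sumG] _] := esd_gen_itv G `[a, b]; apply: sumG XYZ _ _.
- move=> X [a [b [ab GX]]]; exists (a - 1), (b - 1); split; first lia.
  by apply: (gen_itv_shift (n := 1)) GX => i; rewrite !in_itv /=; lia.
- move=> X [a [b [ab GX]]]; exists (a + 1), (b + 1); split; first lia.
  by apply: (gen_itv_shift (n := -1)) GX => i; rewrite !in_itv /=; lia.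
- move=> X Y Z f g h /dist_rot fgh QX QY.
  have [a [b [ab GX GY]]] := joinQ _ _ QX QY.
  (* The cone is an extension of X[1] by Y, and X[1] has range [a-1, b-1]. *)
  exists (a - 1), b; split; first lia.
  have [extG _ _] := esd_gen_itv G `[a - 1, b].
  apply: (extG _ _ _ _ _ _ fgh); first by apply: subQ GY; lia.
  by apply: (gen_itv_shift (n := 1)) GX => i; rewrite !in_itv /=; lia.
Qed.

Lemma width_thick G P : thick G P -> exists (w : nat) (a b : int),
  [/\ b - a = w%:Z, gen_itv G `[a, b] P & width G P = (w%:Z)%:E].
Proof.
case/thick_gen_itv=> a [b [ab GP]].
have [|w [c [d [_ cd GP']]] wE] := @nat_infE
  [set n | exists a b : int, [/\ a <= b, b - a = n%:Z & gen_itv G `[a, b] P]]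
  `|b - a|%N.
  by exists a, b; split=> //; lia.
by exists w, c, d.
Qed.

Lemma lower_indexE G :
  (exists N : int, forall n : int, N < n -> hom_zero (shiftz G n) G) ->
  exists2 o : nat, (forall i : int, o%:Z < i -> hom_zero (shiftz G i) G)
    & lower_index G = (o%:Z)%:E.
Proof.
case=> N N0; apply: (@nat_infE [set b : nat | forall i : int, _] `|N|%N).
by move=> i Ni; apply: N0; lia.
Qed.

End Dimension.

(** * The two inequalities *)

Section Recollement.
Variables (R S T : triCat).
Variables (iu : triFunctor S R) (il : triFunctor R S).
Variables (jl : triFunctor T S) (ju : triFunctor S T).
Hypothesis rec : left_recollement iu il jl ju.

Lemma hom_zero_il (X Y : R) : hom_zero (il X) (il Y) <-> hom_zero X Y.
Proof.
have [g gK Kg] := recoll_i_ff rec X Y.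
split=> XY0 f; last by rewrite -(Kg f) (XY0 (g f)) raddf0.
by rewrite -(gK f) -(gK 0) (XY0 (fmap il f)) (XY0 (fmap il 0)).
Qed.

(** As [il] is full, the unit at [il X] is the image of a map X -> iu il X, which inverts the
    counit. *)
Lemma iu_il (X : R) : isomorphic (iu (il X)) X.
Proof.
exists (adj_counit (recoll_i rec) X).
have [g gK Kg] := recoll_i_ff rec X (iu (il X)).
pose u := adj_unit (recoll_i rec) (il X).
have gu : fmap il (g u) = u by exact: Kg.
exists (g u); have cu : adj_counit (recoll_i rec) X \co g u = idm X.
  have [h hK _] := recoll_i_ff rec X X.
  rewrite -[LHS]hK -[RHS]hK; congr h.
  by rewrite fmapM gu fmap1; exact: unit_counitR.
split=> //.
have nat : g u \co adj_counit (recoll_i rec) X =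
    adj_counit (recoll_i rec) (iu (il X)) \co fmap iu (fmap il (g u)).
  exact: esym (counit_natural (recoll_i rec) (g u)).
by rewrite nat gu; exact: unit_counitL.
Qed.

Lemma findim_quotient_le (GR : R) (GS : S) (n w : nat) (a b : int) :
  right_perp GS `<=` shift_sub (gen_itv GS `[0, +oo[) n%:Z ->
  b - a = w%:Z -> gen_itv GR `[a, b] (iu GS) ->
  (findim GR <= ((n + w)%N%:Z)%:E)%E.
Proof.
move=> GSn ab GRw; apply: findim_le => X GRX.
have ilX_perp k : b < k -> hom_zero (shiftz GS k) (il X).
  move=> bk; apply/(adj_hom_zero (recoll_i rec)).
  apply: hom_zero_isol (isomorphic_sym (tri_shiftz _ _ _)) _.
  apply: gen_itv_hom_zerol GRw _ => i; rewrite in_itv /= => /andP[_ ib].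
  have -> : k - i = `|k - i|%N%:Z by lia.
  by apply: GRX; lia.
(* The lower end is -(n+b) over [iu GS], hence a - (n+b) = -(n+w) over [GR]. *)
have /(gen_itv_fmap (F := iu)) := right_perp_gen_itv GSn ilX_perp.
move/(gen_itv_iso (iu_il X)); apply: gen_itv_trans GRw _ => i j.
by rewrite !in_itv /=; lia.
Qed.

Lemma findim_recollement_le (GR : R) (GS : S) (GT : T)
    (r t w1 w2 o : nat) (a b c d : int) :
  right_perp GR `<=` shift_sub (gen_itv GR `[0, +oo[) r%:Z ->
  right_perp GT `<=` shift_sub (gen_itv GT `[0, +oo[) t%:Z ->
  b - a = w1%:Z -> gen_itv GS `[a, b] (il GR) ->
  d - c = w2%:Z -> gen_itv GS `[c, d] (jl GT) ->
  (forall i : int, o%:Z < i -> hom_zero (shiftz GS i) GS) ->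
  (findim GS <= ((r + t + w1 + w2 + o + 1)%N%:Z)%:E)%E.
Proof.
move=> GRr GTt ab GSi cd GSj GSo; apply: findim_le => X GSX.
have GSX0 (k : int) : 0 < k -> hom_zero (shiftz GS k) X.
  by case: k => // k k_gt0; apply: GSX.
have juX_perp k : d < k -> hom_zero (shiftz GT k) (ju X).
  move=> dk; apply/(adj_hom_zero (recoll_j rec)).
  apply: hom_zero_isol (isomorphic_sym (tri_shiftz _ _ _)) _.
  apply: gen_itv_hom_zerol GSj _ => i; rewrite in_itv /= => /andP[_ id].
  by apply: GSX0; lia.
(* The lower end is -(t+d) over [jl GT], and c - (t+d) = -(t+w2). *)
have jjX : gen_itv GS `[- (t + w2)%N%:Z, +oo[ (jl (ju X)).
  have /(gen_itv_fmap (F := jl)) := right_perp_gen_itv GTt juX_perp.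
  apply: gen_itv_trans GSj _ => i j; rewrite !in_itv /=; lia.
have [h X_tri] := recoll_dist rec X.
(* By rotation, il iu X is an extension of jl ju X[1] by X. The shift lowers the range to -(t+w2+1),
   and Hom(GS[k], GS[-i]) vanishes once k + i > o. *)
have GS_iiX k : (t + w2 + o + 1)%N%:Z < k -> hom_zero (shiftz GS k) (il (iu X)).
  move=> k_gt; have /dist_rot := X_tri.
  have [extP _ _] := esd_hom_zeror (shiftz GS k).
  move=> X_tri'; apply: (extP _ _ _ _ _ _ X_tri'); first by apply: GSX0; lia.
  have jjX1 : gen_itv GS `[- (t + w2 + 1)%N%:Z, +oo[ (shift (jl (ju X))).
    by apply: (gen_itv_shift (n := 1)) jjX => i; rewrite !in_itv /=; lia.
  apply: gen_itv_hom_zeror jjX1 _ => i; rewrite in_itv /= andbT => i_ge.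
  by apply: hom_zero_shiftzl; apply: GSo; lia.
have iuX_perp k :
    (t + w2 + o + 1)%N%:Z + b < k -> hom_zero (shiftz GR k) (iu X).
  move=> k_gt; apply/hom_zero_il.
  apply: hom_zero_isol (isomorphic_sym (tri_shiftz _ _ _)) _.
  apply: gen_itv_hom_zerol GSi _ => i; rewrite in_itv /= => /andP[_ ib].
  by apply: GS_iiX; lia.
(* Here b from [iuX_perp] and a from [GSi] combine to the width w1. *)
have iiX : gen_itv GS `[- (r + t + w1 + w2 + o + 1)%N%:Z, +oo[ (il (iu X)).
  have /(gen_itv_fmap (F := il)) := right_perp_gen_itv GRr iuX_perp.
  apply: gen_itv_trans GSi _ => i j; rewrite !in_itv /=; lia.
have [extG _ _] := esd_gen_itv GS `[- (r + t + w1 + w2 + o + 1)%N%:Z, +oo[.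
apply: (extG _ _ _ _ _ _ X_tri) iiX.
by apply: gen_itv_sub jjX => i; rewrite !in_itv /=; lia.
Qed.

End Recollement.

Theorem theorem1p2 (R S T : triCat)
    (iu : triFunctor S R) (il : triFunctor R S)
    (jl : triFunctor T S) (ju : triFunctor S T)
    (rec : left_recollement iu il jl ju)
    (GR : R) (GS : S) (GT : T) :
  ((exists N : int, forall n : int, (N < n)%R -> hom_zero (shiftz GS n) GS) ->
   thick GS (il GR) -> thick GS (jl GT) ->
   (findim GS <= findim GR + findim GT + width GS (il GR) + width GS (jl GT)
                 + lower_index GS + 1)%E
   /\ (findim GR \is a fin_num -> findim GT \is a fin_num ->
       findim GS \is a fin_num))
  /\
  (thick GR (iu GS) ->
   (findim GR <= findim GS + width GR (iu GS))%E
   /\ (findim GS \is a fin_num -> findim GR \is a fin_num)).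
Proof.
split=> [GS_o GSi GSj|GRi].
- have [w1 [a [b [ab {}GSi ->]]]] := width_thick GSi.
  have [w2 [c [d [cd {}GSj ->]]]] := width_thick GSj.
  have [o {}GS_o ->] := lower_indexE GS_o.
  have [[r GRr ->]|->] := findimP GR; last first.
    (* The case split on [GT] rules out -oo, so the right-hand side is +oo and the finiteness claim
       is vacuous. *)
    by have [[t _ ->]|->] := findimP GT; rewrite leey.
  have [[t GTt ->]|->] := findimP GT; last by rewrite leey.
  have GS_le := findim_recollement_le rec GRr GTt ab GSi cd GSj GS_o.
  split=> [|_ _]; first by rewrite -!EFinD -!PoszD.
  by have [[n _ ->]|GSoo] := findimP GS; rewrite // GSoo in GS_le.
- have [w [a [b [ab {}GRi ->]]]] := width_thick GRi.
  have [[n GSn ->]|->] := findimP GS; last by rewrite leey.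
  have GR_le := findim_quotient_le rec GSn ab GRi.
  split=> [|_]; first by rewrite -EFinD -PoszD.
  by have [[m _ ->]|GRoo] := findimP GR; rewrite // GRoo in GR_le.
Qed.
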